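(* Let $\Theta=\{(a,b)\in[0,1]^2\mid a\leq b\}$ and let $\boldsymbol\Theta=(\Theta,(0,0),(1,1),(0,1),\neg,\Delta,\nabla,\oplus,\odot)$ with, for $(a,b),(c,d)\in\Theta$: $\neg(a,b)=(\neg b,\neg a)$, $\Delta(a,b)=(a,a)$, $\nabla(a,b)=(b,b)$, $(a,b)\oplus(c,d)=(a\oplus c,b\oplus d)$, $(a,b)\odot(c,d)=(a\odot c,b\odot d)$, where on $[0,1]$ we use $\neg a=1-a$, $a\oplus c=\min(1,a+c)$, $a\odot c=\max(0,a+c-1)$. Then the map $\omega\colon\mathcal I([0,1])\to\Theta$, $[a,b]\mapsto(a,b)$, is an isomorphism of IMV-algebras $\mathcal I([0,1])\cong\boldsymbol\Theta$. Moreover, the variety of IMV-algebras equals $\mathbb{HSP}(\mathcal I([0,1]))=\mathbb{HSP}(\boldsymbol\Theta)$. Consequently, an equation holds in all IMV-algebras if and only if it holds in $\mathcal I([0,1])$.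
   Context: $\mathbb{HSP}(K)$ denotes the class of homomorphic images of subalgebras of direct products of copies of $K$ (the variety generated by $K$). An IMV-algebra is an algebra $J=(J,0,1,\iota,\neg,\Delta,\nabla,\oplus,\odot)$ of type $(0,0,0,1,1,1,2,2)$ satisfying the equations: $x\oplus(y\oplus z)=(x\oplus y)\oplus z$; $x\oplus y=y\oplus x$; $x\oplus 0=x$; $x\oplus\neg 0=\neg 0$; $\neg\neg x=x$; $\neg(\neg\Delta x\oplus\Delta y)\oplus\Delta y=\neg(\neg\Delta y\oplus\Delta x)\oplus\Delta x$; $x\odot y=\neg(\neg x\oplus\neg y)$; $1=\neg 0$; $\nabla x=\neg\Delta\neg x$; $\neg\iota=\iota$; $\Delta 0=0$; $\Delta 1=1$; $\Delta\iota=0$; $\Delta\Delta x=\Delta x$; $\Delta\nabla x=\nabla x$; $\Delta(x\oplus y)=\Delta x\oplus\Delta y$; $\Delta(x\odot y)=\Delta x\odot\Delta y$; $\Delta x\odot\neg\nabla x=0$; $\Delta x\oplus(\iota\odot\nabla x\odot\neg\Delta x)=x$. $\mathcal I([0,1])$ is the algebra of closed intervals $[a,b]\subseteq[0,1]$ ($a\leq b$) of the standard MV-algebra $[0,1]$, with constants $0=[0,0]$, $1=[1,1]$, $\iota=[0,1]$, operations $\neg x=\{\neg\alpha\mid\alpha\in x\}$, $x\oplus y=\{\alpha\oplus\beta\mid\alpha\in x,\beta\in y\}$, $x\odot y=\{\alpha\odot\beta\mid\alpha\in x,\beta\in y\}$ (intervals again), $\Delta[a,b]=[a,a]$, $\nabla[a,b]=[b,b]$.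 *)

(* Defs.v *)
From mathcomp Require Import all_boot all_order all_algebra.
From mathcomp Require Import lra.
From mathcomp Require Import boolp classical_sets set_interval reals real_interval.

Set Implicit Arguments.
Unset Strict Implicit.
Unset Printing Implicit Defensive.

Import Order.TTheory GRing.Theory Num.Theory.
Local Open Scope classical_set_scope.
Local Open Scope ring_scope.

Record algebra := Algebra {
  carrier :> Type;
  zero : carrier;
  one : carrier;
  ciota : carrier;
  neg : carrier -> carrier;
  delta : carrier -> carrier;
  nabla : carrier -> carrier;
  oplus : carrier -> carrier -> carrier;
  odot : carrier -> carrier -> carrier
}.
Arguments zero {a}.
Arguments one {a}.
Arguments ciota {a}.

Record is_IMV (J : algebra) : Prop := {
  imv_oplusA : forall x y z : J, oplus x (oplus y z) = oplus (oplus x y) z;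
  imv_oplusC : forall x y : J, oplus x y = oplus y x;
  imv_oplus0 : forall x : J, oplus x zero = x;
  imv_oplusN0 : forall x : J, oplus x (neg zero) = neg zero;
  imv_negK : forall x : J, neg (neg x) = x;
  imv_lukasiewicz : forall x y : J,
    oplus (neg (oplus (neg (delta x)) (delta y))) (delta y) =
    oplus (neg (oplus (neg (delta y)) (delta x))) (delta x);
  imv_odotE : forall x y : J, odot x y = neg (oplus (neg x) (neg y));
  imv_oneE : one = neg zero :> J;
  imv_nablaE : forall x : J, nabla x = neg (delta (neg x));
  imv_neg_iota : neg ciota = ciota :> J;
  imv_delta0 : delta zero = zero :> J;
  imv_delta1 : delta one = one :> J;
  imv_delta_iota : delta ciota = zero :> J;
  imv_delta_delta : forall x : J, delta (delta x) = delta x;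
  imv_delta_nabla : forall x : J, delta (nabla x) = nabla x;
  imv_delta_oplus : forall x y : J,
    delta (oplus x y) = oplus (delta x) (delta y);
  imv_delta_odot : forall x y : J,
    delta (odot x y) = odot (delta x) (delta y);
  imv_delta_nabla0 : forall x : J, odot (delta x) (neg (nabla x)) = zero;
  imv_decomp : forall x : J,
    oplus (delta x) (odot (odot ciota (nabla x)) (neg (delta x))) = x
}.

Record is_hom (A B : algebra) (f : A -> B) : Prop := {
  hom_zero : f zero = zero;
  hom_one : f one = one;
  hom_iota : f ciota = ciota;
  hom_neg : forall x, f (neg x) = neg (f x);
  hom_delta : forall x, f (delta x) = delta (f x);
  hom_nabla : forall x, f (nabla x) = nabla (f x);
  hom_oplus : forall x y, f (oplus x y) = oplus (f x) (f y);
  hom_odot : forall x y, f (odot x y) = odot (f x) (f y)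
}.

Definition is_iso (A B : algebra) (f : A -> B) : Prop :=
  is_hom f /\ bijective f.

Definition power (K : algebra) (I : Type) : algebra :=
  @Algebra (I -> K)
    (fun=> zero) (fun=> one) (fun=> ciota)
    (fun x i => neg (x i)) (fun x i => delta (x i)) (fun x i => nabla (x i))
    (fun x y i => oplus (x i) (y i)) (fun x y i => odot (x i) (y i)).

Record subuniverse (B : algebra) := Subuniverse {
  sub_mem :> B -> Prop;
  sub_zero : sub_mem zero;
  sub_one : sub_mem one;
  sub_iota : sub_mem ciota;
  sub_neg : forall x, sub_mem x -> sub_mem (neg x);
  sub_delta : forall x, sub_mem x -> sub_mem (delta x);
  sub_nabla : forall x, sub_mem x -> sub_mem (nabla x);
  sub_oplus : forall x y, sub_mem x -> sub_mem y -> sub_mem (oplus x y);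
  sub_odot : forall x y, sub_mem x -> sub_mem y -> sub_mem (odot x y)
}.

Definition subalgebra (B : algebra) (S : subuniverse B) : algebra :=
  @Algebra {x : B | S x}
    (exist _ _ (sub_zero S)) (exist _ _ (sub_one S)) (exist _ _ (sub_iota S))
    (fun x => exist _ _ (sub_neg (proj2_sig x)))
    (fun x => exist _ _ (sub_delta (proj2_sig x)))
    (fun x => exist _ _ (sub_nabla (proj2_sig x)))
    (fun x y => exist _ _ (sub_oplus (proj2_sig x) (proj2_sig y)))
    (fun x y => exist _ _ (sub_odot (proj2_sig x) (proj2_sig y))).

Definition HSP (K A : algebra) : Prop :=
  exists (I : Type) (S : subuniverse (power K I)) (f : subalgebra S -> A),
    is_hom f /\ (forall y : A, exists x, f x = y).

Inductive term : Type :=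
| Var of nat
| Zero
| One
| Iota
| Neg of term
| Delta of term
| Nabla of term
| Oplus of term & term
| Odot of term & term.

Fixpoint eval (A : algebra) (v : nat -> A) (t : term) : A :=
  match t with
  | Var n => v n
  | Zero => zero
  | One => one
  | Iota => ciota
  | Neg s => neg (eval v s)
  | Delta s => delta (eval v s)
  | Nabla s => nabla (eval v s)
  | Oplus s u => oplus (eval v s) (eval v u)
  | Odot s u => odot (eval v s) (eval v u)
  end.

Definition satisfies (A : algebra) (s t : term) : Prop :=
  forall v : nat -> A, eval v s = eval v t.

Section Standard.
Variable R : realType.
Implicit Types (a b c d : R) (A B : set R).

(* These are only used on arguments in [0,1]. *)
Definition mv_neg a : R := 1 - a.
Definition mv_oplus a c : R := Num.min 1 (a + c).
Definition mv_odot a c : R := Num.max 0 (a + c - 1).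

Definition bounds01 a b : bool := [&& 0 <= a, a <= b & b <= 1].

Definition is_interval01 A : Prop :=
  exists a b, bounds01 a b /\ A = `[a, b]%classic.

Definition interval01 : Type := {A : set R | is_interval01 A}.

Definition mk_interval01 a b (h : bounds01 a b) : interval01 :=
  exist _ `[a, b]%classic (ex_intro _ a (ex_intro _ b (conj h erefl))).

Definition neg_set A : set R := [set mv_neg x | x in A].
Definition oplus_set A B : set R := [set mv_oplus x y | x in A & y in B].
Definition odot_set A B : set R := [set mv_odot x y | x in A & y in B].
(* For A = [a, b] with a <= b, inf A = a and sup A = b. *)
Definition delta_set A : set R := `[inf A, inf A]%classic.
Definition nabla_set A : set R := `[sup A, sup A]%classic.

Lemma bounds01_00 : bounds01 0 0.
Proof. by rewrite /bounds01 lexx ler01. Qed.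

Lemma bounds01_11 : bounds01 1 1.
Proof. by rewrite /bounds01 lexx ler01. Qed.

Lemma bounds01_01 : bounds01 0 1.
Proof. by rewrite /bounds01 !lexx ler01. Qed.

Lemma bounds01_neg a b : bounds01 a b -> bounds01 (mv_neg b) (mv_neg a).
Proof.
by move=> /and3P[a0 ab b1]; rewrite /mv_neg; apply/and3P; split; lra.
Qed.

Lemma bounds01_delta a b : bounds01 a b -> bounds01 a a.
Proof. by move=> /and3P[a0 ab b1]; apply/and3P; split; lra. Qed.

Lemma bounds01_nabla a b : bounds01 a b -> bounds01 b b.
Proof. by move=> /and3P[a0 ab b1]; apply/and3P; split; lra. Qed.

Lemma bounds01_oplus a b c d : bounds01 a b -> bounds01 c d ->
  bounds01 (mv_oplus a c) (mv_oplus b d).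
Proof.
move=> /and3P[a0 ab b1] /and3P[c0 cd d1]; rewrite /mv_oplus.
by apply/and3P; split; case: (leP 1 (a + c)); case: (leP 1 (b + d)) => *; lra.
Qed.

Lemma bounds01_odot a b c d : bounds01 a b -> bounds01 c d ->
  bounds01 (mv_odot a c) (mv_odot b d).
Proof.
move=> /and3P[a0 ab b1] /and3P[c0 cd d1]; rewrite /mv_odot.
by apply/and3P; split;
  case: (leP 0 (a + c - 1)); case: (leP 0 (b + d - 1)) => *; lra.
Qed.

Lemma itv01E a b x : (`[a, b]%classic : set R) x = (a <= x <= b) :> Prop.
Proof. by rewrite /= in_itv. Qed.

Lemma neg_setE a b : neg_set `[a, b]%classic = `[mv_neg b, mv_neg a]%classic.
Proof.
rewrite /neg_set /mv_neg; apply/seteqP; split => x.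
  move=> [y]; rewrite !itv01E => /andP[ay yb] <-.
  by apply/andP; split; lra.
rewrite itv01E => /andP[bx xa]; exists (1 - x); last by lra.
by rewrite itv01E; apply/andP; split; lra.
Qed.

Lemma delta_setE a b : bounds01 a b -> delta_set `[a, b]%classic = `[a, a]%classic.
Proof. by move=> /and3P[_ ab _]; rewrite /delta_set inf_itv// bnd_simp. Qed.

Lemma nabla_setE a b : bounds01 a b -> nabla_set `[a, b]%classic = `[b, b]%classic.
Proof. by move=> /and3P[_ ab _]; rewrite /nabla_set sup_itv// bnd_simp. Qed.

Lemma split_add a b c d z : a <= b -> c <= d -> a + c <= z <= b + d ->
  exists x y, [/\ a <= x <= b, c <= y <= d & x + y = z].
Proof.
move=> ab cd /andP[h1 h2]; have [h|h] := leP b (z - c).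
- by exists b, (z - b); split; [apply/andP; split; lra..|lra].
- by exists (z - c), c; split; [apply/andP; split; lra..|lra].
Qed.

Lemma oplus_setE a b c d : bounds01 a b -> bounds01 c d ->
  oplus_set `[a, b]%classic `[c, d]%classic = `[mv_oplus a c, mv_oplus b d]%classic.
Proof.
move=> /and3P[a0 ab b1] /and3P[c0 cd d1]; rewrite /oplus_set /mv_oplus.
apply/seteqP; split => z.
  move=> [x]; rewrite itv01E => /andP[ax xb] [y].
  rewrite itv01E => /andP[cy yd] <-; rewrite itv01E.
  by apply/andP; split; case: (leP 1 (x + y));
    case: (leP 1 (a + c)); case: (leP 1 (b + d)) => *; lra.
rewrite itv01E => /andP[]; rewrite le_min ge_min => h1 /andP[z1 h2].
have [zlt|zge] := ltP z 1.
- have acz : a + c <= z by case/orP: h1 => *; lra.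
  have [|x [y [hx hy xy]]] := @split_add a b c d z ab cd.
    by rewrite acz h2.
  exists x; first by rewrite itv01E.
  exists y; first by rewrite itv01E.
  by rewrite xy; apply/min_idPr.
- exists b; first by rewrite itv01E lexx ab.
  exists d; first by rewrite itv01E lexx cd.
  by case: (leP 1 (b + d)) => *; lra.
Qed.

Lemma odot_setE a b c d : bounds01 a b -> bounds01 c d ->
  odot_set `[a, b]%classic `[c, d]%classic = `[mv_odot a c, mv_odot b d]%classic.
Proof.
move=> /and3P[a0 ab b1] /and3P[c0 cd d1]; rewrite /odot_set /mv_odot.
apply/seteqP; split => z.
  move=> [x]; rewrite itv01E => /andP[ax xb] [y].
  rewrite itv01E => /andP[cy yd] <-; rewrite itv01E.
  by apply/andP; split; case: (leP 0 (x + y - 1));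
    case: (leP 0 (a + c - 1)); case: (leP 0 (b + d - 1)) => *; lra.
rewrite itv01E => /andP[]; rewrite ge_max le_max => /andP[z0 h1] h2.
have [zgt|zle] := ltP 0 z.
- have zbd : z + 1 <= b + d by case/orP: h2 => *; lra.
  have [|x [y [hx hy xy]]] := @split_add a b c d (z + 1) ab cd.
    by apply/andP; split; lra.
  exists x; first by rewrite itv01E.
  exists y; first by rewrite itv01E.
  by rewrite xy addrK; apply/max_idPr.
- exists a; first by rewrite itv01E lexx ab.
  exists c; first by rewrite itv01E lexx cd.
  by case: (leP 0 (a + c - 1)) => *; lra.
Qed.

Lemma neg_setP A : is_interval01 A -> is_interval01 (neg_set A).
Proof.
move=> [a [b [h ->]]]; exists (mv_neg b), (mv_neg a).
by split; [exact: bounds01_neg|exact: neg_setE].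
Qed.

Lemma delta_setP A : is_interval01 A -> is_interval01 (delta_set A).
Proof.
move=> [a [b [h ->]]]; exists a, a.
by split; [exact: bounds01_delta h|exact: delta_setE].
Qed.

Lemma nabla_setP A : is_interval01 A -> is_interval01 (nabla_set A).
Proof.
move=> [a [b [h ->]]]; exists b, b.
by split; [exact: bounds01_nabla h|exact: nabla_setE].
Qed.

Lemma oplus_setP A B :
  is_interval01 A -> is_interval01 B -> is_interval01 (oplus_set A B).
Proof.
move=> [a [b [h ->]]] [c [d [k ->]]]; exists (mv_oplus a c), (mv_oplus b d).
by split; [exact: bounds01_oplus|exact: oplus_setE].
Qed.

Lemma odot_setP A B :
  is_interval01 A -> is_interval01 B -> is_interval01 (odot_set A B).
Proof.
move=> [a [b [h ->]]] [c [d [k ->]]]; exists (mv_odot a c), (mv_odot b d).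
by split; [exact: bounds01_odot|exact: odot_setE].
Qed.

Definition I01 : algebra :=
  @Algebra interval01
    (mk_interval01 bounds01_00)
    (mk_interval01 bounds01_11)
    (mk_interval01 bounds01_01)
    (fun x => exist _ _ (neg_setP (proj2_sig x)))
    (fun x => exist _ _ (delta_setP (proj2_sig x)))
    (fun x => exist _ _ (nabla_setP (proj2_sig x)))
    (fun x y => exist _ _ (oplus_setP (proj2_sig x) (proj2_sig y)))
    (fun x y => exist _ _ (odot_setP (proj2_sig x) (proj2_sig y))).

Definition theta : Type := {p : R * R | bounds01 p.1 p.2}.

Definition mk_theta a b (h : bounds01 a b) : theta :=
  exist (fun p : R * R => bounds01 p.1 p.2) (a, b) h.

Definition Theta : algebra :=
  @Algebra theta
    (mk_theta bounds01_00)
    (mk_theta bounds01_11)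
    (mk_theta bounds01_01)
    (fun p => mk_theta (bounds01_neg (proj2_sig p)))
    (fun p => mk_theta (bounds01_delta (proj2_sig p)))
    (fun p => mk_theta (bounds01_nabla (proj2_sig p)))
    (fun p q => mk_theta (bounds01_oplus (proj2_sig p) (proj2_sig q)))
    (fun p q => mk_theta (bounds01_odot (proj2_sig p) (proj2_sig q))).

Lemma inf_sup_bounds01 A : is_interval01 A -> bounds01 (inf A) (sup A).
Proof.
move=> [a [b [h ->]]]; have /and3P[_ ab _] := h.
by rewrite inf_itv ?bnd_simp// sup_itv ?bnd_simp.
Qed.

Definition omega (x : I01) : Theta :=
  mk_theta (inf_sup_bounds01 (proj2_sig x)).

End Standard.

(* Main.v *)
From HB Require Import structures.
From mathcomp Require Import all_boot all_order all_algebra.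
From mathcomp Require Import zify lra.
From mathcomp Require Import boolp classical_sets set_interval reals real_interval.
Require Import Defs.

Set Implicit Arguments.
Unset Strict Implicit.
Unset Printing Implicit Defensive.
Import Order.TTheory GRing.Theory Num.Theory.
Local Open Scope classical_set_scope.

(** The hard point is that every IMV-algebra [A] is a homomorphic image of the
    subalgebra generated by the projections in a power of [Theta R]: if two
    expressions in elements of [A] have distinct values [a], [b] in [A], then some
    valuation of those elements in [Theta R] must separate them.  Since [x] is
    recovered from [Δ x] and [∇ x], the values are already separated in the
    MV-algebra of fixed points of [Δ], hence, modulo a prime ideal, in an
    MV-chain.  Chang's construction embeds the chain as the unit interval of a
    totally ordered abelian group.  Only finitely many group elements occur in
    the evaluation of the two expressions, and by Fourier-Motzkin elimination
    some real function on the group is additive and nonnegative on them and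
    still separates [a] from [b]; normalized, it gives the valuation. *)

(** * MV-algebras *)

Record mv := MV {
  mv_car :> Type;
  mv0 : mv_car;
  mvN : mv_car -> mv_car;
  mvD : mv_car -> mv_car -> mv_car;
  mvDA : associative mvD;
  mvDC : commutative mvD;
  mvD0 : right_id mv0 mvD;
  mvD1 : right_zero (mvN mv0) mvD;
  mvNK : involutive mvN;
  mvDNC : forall x y, mvD (mvN (mvD (mvN x) y)) y = mvD (mvN (mvD (mvN y) x)) x
}.
Arguments mv0 {m}.
Arguments mvN {m}.
Arguments mvD {m}.

Declare Scope mv_scope.
Delimit Scope mv_scope with mv.
Local Open Scope mv_scope.
Notation "0" := mv0 : mv_scope.
Notation "1" := (mvN mv0) : mv_scope.
Notation "¬ x" := (mvN x) (at level 35, right associativity) : mv_scope.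
Notation "x ⊕ y" := (mvD x y) (at level 50, left associativity) : mv_scope.
Definition mvM (M : mv) (x y : M) : M := ¬ (¬ x ⊕ ¬ y).
Notation "x ⊙ y" := (mvM x y) (at level 40, left associativity) : mv_scope.
Definition mv_le (M : mv) (x y : M) : Prop := ¬ x ⊕ y = 1.
Notation "x ⊑ y" := (mv_le x y) (at level 70, no associativity) : mv_scope.

Section MVTheory.
Variable M : mv.
Implicit Types x y z : M.

Lemma mv0D x : 0 ⊕ x = x. Proof. by rewrite mvDC mvD0. Qed.
Lemma mv1D x : 1 ⊕ x = 1. Proof. by rewrite mvDC mvD1. Qed.
Lemma mvND x : ¬ x ⊕ x = 1.
Proof. by have := mvDNC x (1 : M); rewrite !mvD1 mvNK mv0D => <-. Qed.
Lemma mvDN x : x ⊕ ¬ x = 1. Proof. by rewrite mvDC mvND. Qed.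

Lemma mvMC x y : x ⊙ y = y ⊙ x. Proof. by rewrite /mvM mvDC. Qed.
Lemma mvMA x y z : x ⊙ (y ⊙ z) = x ⊙ y ⊙ z.
Proof. by rewrite /mvM !mvNK mvDA. Qed.
Lemma mvM1 x : x ⊙ 1 = x. Proof. by rewrite /mvM mvNK mvD0 mvNK. Qed.
Lemma mv1M x : 1 ⊙ x = x. Proof. by rewrite mvMC mvM1. Qed.
Lemma mvM0 x : x ⊙ 0 = 0. Proof. by rewrite /mvM mvD1 mvNK. Qed.
Lemma mv0M x : 0 ⊙ x = 0. Proof. by rewrite mvMC mvM0. Qed.
Lemma mvMN x : x ⊙ ¬ x = 0. Proof. by rewrite /mvM mvDN mvNK. Qed.
Lemma mvNM x y : ¬ (x ⊙ y) = ¬ x ⊕ ¬ y. Proof. by rewrite /mvM mvNK. Qed.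

(** This is axiom [mvDNC] in terms of [⊙]; either side is the lattice join. *)
Lemma mv_joinC x y : x ⊙ ¬ y ⊕ y = y ⊙ ¬ x ⊕ x.
Proof. by rewrite /mvM !mvNK mvDNC. Qed.

Lemma mv_leP x y : x ⊑ y <-> exists z, y = x ⊕ z.
Proof.
rewrite /mv_le; split=> [xy|[z ->]]; last by rewrite mvDA mvND mv1D.
by exists (¬ (¬ y ⊕ x)); rewrite mvDC -mvDNC xy mvNK mv0D.
Qed.
Lemma mv_le_refl x : x ⊑ x. Proof. exact: mvND. Qed.
Lemma mv_le_trans y x z : x ⊑ y -> y ⊑ z -> x ⊑ z.
Proof.
move=> /mv_leP[s ->] /mv_leP[t ->]; apply/mv_leP.
by exists (s ⊕ t); rewrite mvDA.
Qed.
Lemma mv_le_anti x y : x ⊑ y -> y ⊑ x -> x = y.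
Proof.
by move=> xy yx; have := mvDNC x y; rewrite xy yx mvNK !mv0D.
Qed.
Lemma mv_le0 x : 0 ⊑ x. Proof. by rewrite /mv_le mv1D. Qed.
Lemma mv_le_0 x : x ⊑ 0 -> x = 0.
Proof. by move=> /mv_le_anti; apply; exact: mv_le0. Qed.
Lemma mv_le1 x : x ⊑ 1. Proof. by rewrite /mv_le mvD1. Qed.
Lemma mv_leN x y : x ⊑ y -> ¬ y ⊑ ¬ x.
Proof. by rewrite /mv_le mvNK mvDC. Qed.
Lemma mv_leDl x y : x ⊑ x ⊕ y. Proof. by apply/mv_leP; exists y. Qed.
Lemma mv_leDr x y : y ⊑ x ⊕ y. Proof. by rewrite mvDC; exact: mv_leDl. Qed.
Lemma mv_leD x y s t : x ⊑ y -> s ⊑ t -> x ⊕ s ⊑ y ⊕ t.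
Proof.
move=> /mv_leP[a ->] /mv_leP[b ->]; apply/mv_leP; exists (a ⊕ b).
by rewrite -!mvDA; congr (_ ⊕ _); rewrite !mvDA (mvDC a).
Qed.
Lemma mv_leM x y s t : x ⊑ y -> s ⊑ t -> x ⊙ s ⊑ y ⊙ t.
Proof. by move=> xy st; apply/mv_leN/mv_leD; apply: mv_leN. Qed.
Lemma mv_leMl x y : x ⊙ y ⊑ x.
Proof.
by rewrite -[X in _ ⊑ X]mvM1; apply: mv_leM; [exact: mv_le_refl|exact: mv_le1].
Qed.
Lemma mv_leMr x y : x ⊙ y ⊑ y. Proof. by rewrite mvMC; exact: mv_leMl. Qed.

Lemma mv_le_diff x y : x ⊑ y <-> x ⊙ ¬ y = 0.
Proof.
rewrite /mv_le /mvM mvNK; split=> [->|h]; first by rewrite mvNK.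
by rewrite -h mvNK.
Qed.
(** Residuation: [x ⊙ ¬ y] is the truncated difference of [x] and [y]. *)
Lemma mv_resid x y z : x ⊑ y ⊕ z <-> x ⊙ ¬ y ⊑ z.
Proof. by rewrite /mv_le mvNM mvNK mvDA. Qed.
Lemma mv_le_subDK x y : x ⊑ y -> y ⊙ ¬ x ⊕ x = y.
Proof. by rewrite mv_joinC => /mv_le_diff ->; rewrite mv0D. Qed.
Lemma mv_le_subD x y : x ⊑ y ⊕ x ⊙ ¬ y.
Proof. exact/mv_resid/mv_le_refl. Qed.
Lemma mv_join_lub x y z : x ⊑ z -> y ⊑ z -> x ⊙ ¬ y ⊕ y ⊑ z.
Proof.
move=> xz yz; rewrite -(mv_le_subDK yz).
by apply: mv_leD; first apply: mv_leM => //; exact: mv_le_refl.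
Qed.
(** The hypothesis says that the sum is not truncated, so the addition can be undone. *)
Lemma mv_addK x y : y ⊑ ¬ x -> (x ⊕ y) ⊙ ¬ y = x.
Proof.
move=> yx; have := mv_le_subDK yx; rewrite /mvM !mvNK => h.
by rewrite h mvNK.
Qed.

Lemma mv_prelinear x y z : z ⊑ x ⊙ ¬ y -> z ⊑ y ⊙ ¬ x -> z = 0.
Proof.
(* Subtracting [z] from the join [w] of [x] and [y] leaves an upper bound of both. *)
pose w := x ⊙ ¬ y ⊕ y.
have wC : w = y ⊙ ¬ x ⊕ x by rewrite /w mv_joinC.
move=> zxy zyx.
have le_sub v : z ⊑ ¬ v -> z ⊕ v ⊑ w -> v ⊑ w ⊙ ¬ z.
  move=> zv zvw; rewrite -[X in X ⊑ _](mv_addK zv) mvDC.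
  by apply: mv_leM => //; exact: mv_le_refl.
have yw : y ⊑ w ⊙ ¬ z.
  apply: le_sub; first exact: mv_le_trans zxy (mv_leMr _ _).
  by apply: mv_leD => //; exact: mv_le_refl.
have xw : x ⊑ w ⊙ ¬ z.
  apply: le_sub; first exact: mv_le_trans zyx (mv_leMr _ _).
  by rewrite wC; apply: mv_leD => //; exact: mv_le_refl.
have ww : w ⊑ w ⊙ ¬ z by exact: mv_join_lub.
have wE : w ⊙ ¬ z = w by apply: mv_le_anti => //; exact: mv_leMl.
have zw : z ⊑ w by apply: (mv_le_trans zxy); exact: mv_leDl.
have zNw : z ⊑ ¬ w.
  by rewrite -[z]mvNK; apply/mv_leN/(mv_le_trans ww)/mv_leMr.
(* Removing [z] leaves [w] as it is, hence so does adding [z]; as [w ⊑ ¬ z], the term [w] can then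
   be cancelled. *)
have := mv_le_subDK zw; rewrite wE => wz.
have wNz : w ⊑ ¬ z by rewrite -[w]mvNK; exact: mv_leN.
by rewrite -(mv_addK wNz) mvDC wz mvMN.
Qed.

(** In real terms both sides are [x + y + z - 1]. This serves associativity in Chang's group when
    [x + y] carries and [y + z] does not. *)
Lemma mv_mulD_assoc x y z : x ⊕ y = 1 -> y ⊑ ¬ z -> x ⊙ y ⊕ z = x ⊙ (y ⊕ z).
Proof.
move=> xy yz.
have xy' : ¬ x ⊑ y by rewrite /mv_le mvNK.
have yE : x ⊙ y ⊕ ¬ x = y by rewrite -[RHS](mv_le_subDK xy') mvNK (mvMC x).
have zx : z ⊑ x.
  rewrite -[z]mvNK -[x]mvNK; apply: mv_leN.
  exact: mv_le_trans xy' yz.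
have tx : x ⊙ y ⊕ z ⊑ x.
  apply: (@mv_le_trans (x ⊙ ¬ z ⊕ z)).
    by apply: mv_leD; [apply: mv_leM => //|]; exact: mv_le_refl.
  by rewrite (mv_le_subDK zx); exact: mv_le_refl.
(* Adding [¬ x] to [x ⊙ y ⊕ z] gives [y ⊕ z]; by [tx] nothing is truncated, so multiplying by [x]
   removes [¬ x] again. *)
rewrite -{2}yE -mvDA (mvDC (¬ x)) mvDA (mvMC x (_ ⊕ _)).
by have := mv_addK (mv_leN tx); rewrite mvNK.
Qed.

(** The element [¬ y] is split off [z] and given back to [x ⊙ y], which turns [x ⊙ y] into [x]. *)
Lemma mv_mulD_swap x y z : x ⊕ y = 1 -> y ⊕ z = 1 -> x ⊙ y ⊕ z = x ⊕ y ⊙ z.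
Proof.
move=> xy yz.
have yz' : ¬ y ⊑ z by rewrite /mv_le mvNK.
have yx : ¬ y ⊑ x by rewrite /mv_le mvNK mvDC.
rewrite -[in LHS](mv_le_subDK yz') mvNK mvDA -mvDA (mvDC _ (¬ y)) mvDA.
by rewrite -{1}[y]mvNK (mv_le_subDK yx) (mvMC z).
Qed.

End MVTheory.

Record is_mv_hom (M N : mv) (f : M -> N) : Prop := {
  mv_hom0 : f 0 = 0;
  mv_homN : forall x, f (¬ x) = ¬ f x;
  mv_homD : forall x y, f (x ⊕ y) = f x ⊕ f y
}.

Lemma mv_homM (M N : mv) (f : M -> N) : is_mv_hom f ->
  forall x y, f (x ⊙ y) = f x ⊙ f y.
Proof. by move=> h x y; rewrite /mvM !(mv_homN h, mv_homD h). Qed.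

Lemma mv_hom_le (M N : mv) (f : M -> N) : is_mv_hom f ->
  forall x y, x ⊑ y -> f x ⊑ f y.
Proof.
move=> h x y; rewrite /mv_le -(mv_homN h) -(mv_homD h) => ->.
by rewrite (mv_homN h) (mv_hom0 h).
Qed.

(** * Prime ideals and quotients *)

Record is_mv_ideal (M : mv) (I : set M) : Prop := {
  ideal0 : I 0;
  idealD : forall x y, I x -> I y -> I (x ⊕ y);
  ideal_le : forall x y, x ⊑ y -> I y -> I x
}.

Section PrimeIdeal.
Variables (M : mv) (e : M).

Fixpoint mv_mul (n : nat) (x : M) : M :=
  if n is n'.+1 then x ⊕ mv_mul n' x else 0.

Lemma mv_mulDn n m x : mv_mul (n + m) x = mv_mul n x ⊕ mv_mul m x.
Proof. by elim: n => [|n IH]; rewrite ?mv0D//= IH mvDA. Qed.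

Definition ideal_adjoin (I : set M) x : set M :=
  [set y | exists i n, I i /\ y ⊑ i ⊕ mv_mul n x].

Lemma ideal_adjoinP (I : set M) x :
  is_mv_ideal I -> is_mv_ideal (ideal_adjoin I x).
Proof.
move=> hI; split.
- by exists 0, 0%N; split; [exact: ideal0|exact: mv_le0].
- move=> y z [i [n [Ii yi]]] [j [m [Ij zj]]]; exists (i ⊕ j), (n + m)%N.
  split; first exact: idealD.
  have -> : i ⊕ j ⊕ mv_mul (n + m) x = i ⊕ mv_mul n x ⊕ (j ⊕ mv_mul m x).
    rewrite mv_mulDn -!mvDA; congr (_ ⊕ _).
    by rewrite !mvDA (mvDC j).
  exact: mv_leD.
- move=> y z yz [i [n [Ii zi]]]; exists i, n; split=> //.
  exact: mv_le_trans zi.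
Qed.

(** If [z] lies below [a ⊕ mv_mul n a] and below [b], its truncated difference with [mv_mul n a]
    lies below both [a] and [b], so it vanishes and [z ⊑ mv_mul n a]. This induction is run on one
    side, then on the other. *)
Lemma mv_mul_disjoint x y :
  (forall z, z ⊑ x -> z ⊑ y -> z = 0) ->
  forall n m z, z ⊑ mv_mul n x -> z ⊑ mv_mul m y -> z = 0.
Proof.
have step a b : (forall z, z ⊑ a -> z ⊑ b -> z = 0) ->
    forall n z, z ⊑ mv_mul n a -> z ⊑ b -> z = 0.
  move=> ab; elim=> [|n IH] z /=; first by move=> /mv_le_0.
  move=> za zb; apply: IH => //.
  apply/mv_le_diff/ab; last exact: mv_le_trans (mv_leMl _ _) zb.
  by apply/mv_resid; rewrite mvDC.
move=> xy n m z zx zy; apply: (step y (mv_mul n x) _ m) => // t ty tx.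
exact: (step x y xy n).
Qed.

(** The ideal [I] is maximal among those avoiding [e]. If it missed both differences, adjoining
    either one would capture [e]; modulo [I], [e] would then lie below multiples of two disjoint
    elements, which forces [e] into [I]. *)
Lemma prime_ideal : e <> 0 ->
  exists I, [/\ is_mv_ideal I, ~ I e & forall x y, I (x ⊙ ¬ y) \/ I (y ⊙ ¬ x)].
Proof.
move=> e0.
(* Membership of [0] is left out because Zorn's lemma also asks for the union of the empty chain; it
   is recovered by comparing the maximal set with the singleton of [0]. *)
pose avoiding (I : set M) := [/\ forall x y, I x -> I y -> I (x ⊕ y),
  forall x y, x ⊑ y -> I y -> I x & ~ I e].
have [|I [[ID Ile Ie] Imax]] := @Zorn_bigcup M avoiding.
  move=> F FP Ftot; split.
  - move=> x y [X FX Xx] [Y FY Yy].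
    have [XY|YX] := Ftot _ _ FX FY.
      by exists Y => //; case: (FP _ FY) => + _ _; apply=> //; exact: XY.
    by exists X => //; case: (FP _ FX) => + _ _; apply=> //; exact: YX.
  - move=> x y xy [Y FY Yy]; exists Y => //.
    by case: (FP _ FY) => _ + _; apply; [exact: xy|].
  - by move=> [X FX Xe]; case: (FP _ FX) => _ _; apply.
have I0 : I 0.
  apply: contrapT => nI0; apply: (Imax [set 0%mv]).
    split=> [x Ix|/(_ 0%mv erefl)//].
    by case: nI0; apply: Ile Ix; exact: mv_le0.
  split=> [x y -> -> /=|x y xy yE|//]; first by rewrite mvD0.
  by apply: mv_le_0; rewrite -yE.
have hI : is_mv_ideal I by [].
have adj x : ~ I x -> ideal_adjoin I x e.
  move=> nIx; apply: contrapT => ne.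
  apply: (Imax (ideal_adjoin I x)).
    split=> [y Iy|/(_ x) sub].
      by exists y, 0%N; split=> //; exact: mv_leDl.
    apply/nIx/sub; exists 0%mv, 1%N.
    by rewrite /= mv0D mvD0; split=> //; exact: mv_le_refl.
  by have [_ ? ?] := ideal_adjoinP x hI.
exists I; split=> // x y; apply: contrapT => /not_orP[/adj + /adj].
move=> [i [n [Ii ei]]] [j [m [Ij ej]]]; apply: Ie.
have Iij : I (i ⊕ j) by exact: ID.
apply: Ile Iij; apply/mv_le_diff.
apply: (mv_mul_disjoint (@mv_prelinear _ x y) (n := n) (m := m)).
  apply/mv_resid/(mv_le_trans ei)/mv_leD; last exact: mv_le_refl.
  exact: mv_leDl.
apply/mv_resid/(mv_le_trans ej)/mv_leD; last exact: mv_le_refl.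
exact: mv_leDr.
Qed.

End PrimeIdeal.

Section Quotient.
Variables (M : mv) (I : set M).
Hypothesis hI : is_mv_ideal I.

Definition ideal_eqv (x y : M) : Prop := I (x ⊙ ¬ y) /\ I (y ⊙ ¬ x).

Lemma ideal_eqv_refl x : ideal_eqv x x.
Proof. by rewrite /ideal_eqv mvMN; split; exact: ideal0. Qed.

Lemma ideal_eqv_sym x y : ideal_eqv x y -> ideal_eqv y x.
Proof. by case. Qed.

Lemma ideal_eqv_trans y x z : ideal_eqv x y -> ideal_eqv y z -> ideal_eqv x z.
Proof.
have tr a b c : I (a ⊙ ¬ b) -> I (b ⊙ ¬ c) -> I (a ⊙ ¬ c).
  move=> ab bc; apply: (ideal_le hI _ (idealD hI ab bc)).
  apply/(mv_resid a c); apply: (mv_le_trans (mv_le_subD _ b)).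
  rewrite (mvDC (a ⊙ _)) mvDA; apply: mv_leD; last exact: mv_le_refl.
  exact: mv_le_subD.
by move=> [xy yx] [yz zy]; split; [exact: tr xy yz|exact: tr zy yx].
Qed.

Lemma ideal_eqvN x y : ideal_eqv x y -> ideal_eqv (¬ x) (¬ y).
Proof. by rewrite /ideal_eqv !mvNK => -[]; rewrite mvMC (mvMC y). Qed.

Lemma ideal_eqvD x y s t :
  ideal_eqv x y -> ideal_eqv s t -> ideal_eqv (x ⊕ s) (y ⊕ t).
Proof.
have sub a b c d : I (a ⊙ ¬ b) -> I (c ⊙ ¬ d) -> I ((a ⊕ c) ⊙ ¬ (b ⊕ d)).
  move=> ab cd; apply: (ideal_le hI _ (idealD hI ab cd)).
  apply/(mv_resid _ (b ⊕ d)).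
  have -> : b ⊕ d ⊕ (a ⊙ ¬ b ⊕ c ⊙ ¬ d) = (a ⊙ ¬ b ⊕ b) ⊕ (c ⊙ ¬ d ⊕ d).
    rewrite (mvDC (a ⊙ _) b) (mvDC (c ⊙ _) d) -!mvDA; congr (_ ⊕ _).
    by rewrite !mvDA (mvDC d).
  by apply: mv_leD; rewrite mvDC; exact: mv_le_subD.
by move=> [xy yx] [st ts]; split; exact: sub.
Qed.

(** One chosen representative per class makes the quotient a subtype of [M], where equality of
    classes is plain equality. *)
Definition mv_repr (x : M) : M :=
  xget (0%mv : {classic M}) [set y | ideal_eqv x y].

Lemma mv_repr_eqv x : ideal_eqv x (mv_repr x).
Proof.
apply: (@xgetPex {classic M} 0%mv [set y | ideal_eqv x y]).
by exists x; exact: ideal_eqv_refl.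
Qed.

Lemma mv_repr_eq x y : ideal_eqv x y -> mv_repr x = mv_repr y.
Proof.
move=> xy; rewrite /mv_repr.
suff -> : [set z | ideal_eqv x z] = [set z | ideal_eqv y z] by [].
apply/seteqP; split=> z /=.
  by apply: ideal_eqv_trans; exact: ideal_eqv_sym.
exact: ideal_eqv_trans.
Qed.

Definition quot := {x : M | mv_repr x = x}.

Definition quot_pi (x : M) : quot :=
  exist _ (mv_repr x) (esym (mv_repr_eq (mv_repr_eqv x))).

Lemma quot_pi_eq x y : quot_pi x = quot_pi y <-> ideal_eqv x y.
Proof.
split=> [/(congr1 sval)/= xy|/mv_repr_eq xy]; last exact: eq_exist.
apply: (ideal_eqv_trans (mv_repr_eqv x)); rewrite xy.
exact/ideal_eqv_sym/mv_repr_eqv.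
Qed.

Lemma quot_pi_surj (q : quot) : exists x, q = quot_pi x.
Proof. by case: q => x xE; exists x; apply: eq_exist; rewrite xE. Qed.

Definition quotN (p : quot) : quot := quot_pi (¬ sval p).
Definition quotD (p q : quot) : quot := quot_pi (sval p ⊕ sval q).

Lemma quot_piN x : quotN (quot_pi x) = quot_pi (¬ x).
Proof. exact/quot_pi_eq/ideal_eqvN/ideal_eqv_sym/mv_repr_eqv. Qed.

Lemma quot_piD x y : quotD (quot_pi x) (quot_pi y) = quot_pi (x ⊕ y).
Proof.
by apply/quot_pi_eq/ideal_eqvD; exact/ideal_eqv_sym/mv_repr_eqv.
Qed.

Definition quotE := (quot_piN, quot_piD).

Lemma quotDA : associative quotD.
Proof.
move=> p q r; have [[x ->] [y ->] [z ->]] :=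
  And3 (quot_pi_surj p) (quot_pi_surj q) (quot_pi_surj r).
by rewrite !quotE mvDA.
Qed.

Lemma quotDC : commutative quotD.
Proof. by move=> p q; rewrite /quotD mvDC. Qed.

Lemma quotD0 : right_id (quot_pi 0) quotD.
Proof. by move=> p; have [x ->] := quot_pi_surj p; rewrite quotE mvD0. Qed.

Lemma quotD1 : right_zero (quotN (quot_pi 0)) quotD.
Proof. by move=> p; have [x ->] := quot_pi_surj p; rewrite !quotE mvD1. Qed.

Lemma quotNK : involutive quotN.
Proof. by move=> p; have [x ->] := quot_pi_surj p; rewrite !quotE mvNK. Qed.

Lemma quotDNC p q :
  quotD (quotN (quotD (quotN p) q)) q = quotD (quotN (quotD (quotN q) p)) p.
Proof.
have [[x ->] [y ->]] := conj (quot_pi_surj p) (quot_pi_surj q).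
by rewrite !quotE mvDNC.
Qed.

Definition quot_mv : mv := MV quotDA quotDC quotD0 quotD1 quotNK quotDNC.

Lemma quot_pi_hom : @is_mv_hom M quot_mv quot_pi.
Proof. by split=> [|x|x y] //; rewrite /= ?quot_piN ?quot_piD. Qed.

Lemma quot_pi_eq0 x : quot_pi x = 0 :> quot_mv <-> I x.
Proof.
rewrite quot_pi_eq /ideal_eqv mvM1 mv0M; split=> [[]|] //.
by move=> Ix; split=> //; exact: ideal0.
Qed.

End Quotient.

Record mv_chain := MVChain {
  chain_mv :> mv;
  chain_total : forall x y : chain_mv, x ⊑ y \/ y ⊑ x;
  chain_neq01 : 0 <> 1 :> chain_mv
}.

(** The chain is the quotient by a prime ideal omitting [e]: primeness makes it total, and a nonzero
    image of [e] rules out [0 = 1]. *)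
Lemma mv_chain_separation (M : mv) (e : M) : e <> 0 ->
  exists (C : mv_chain) (h : M -> C), is_mv_hom h /\ h e <> 0.
Proof.
move=> /prime_ideal[I [hI nIe Iprime]].
have pi_hom := quot_pi_hom hI.
have total (p q : quot_mv hI) : p ⊑ q \/ q ⊑ p.
  have [[x ->] [y ->]] := conj (quot_pi_surj hI p) (quot_pi_surj hI q).
  by have [xy|yx] := Iprime x y; [left|right]; apply/mv_le_diff;
    rewrite -(mv_homN pi_hom) -(mv_homM pi_hom); exact/quot_pi_eq0.
have neq01 : 0 <> 1 :> quot_mv hI.
  move=> eq01; apply/nIe/(quot_pi_eq0 hI).
  by rewrite -[LHS](@mvM1 (quot_mv hI)) -eq01 mvM0.
exists (MVChain total neq01), (quot_pi hI); split=> //.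
by move=> /quot_pi_eq0.
Qed.

(** * Chang's ordered group of an MV-chain *)

(* [(n, x)] stands for [n + x]; digits differ from [1] to make this unique. *)
Definition digit (C : mv_chain) := {x : C | x <> 1}.
Definition chang (C : mv_chain) := (int * digit C)%type.

HB.instance Definition _ (C : mv_chain) := gen_eqMixin (chang C).
HB.instance Definition _ (C : mv_chain) := gen_choiceMixin (chang C).

Section Chang.
Variable C : mv_chain.
Implicit Types (x y z : C) (n m k : int) (g h : chang C).

(** Normal form of [n + x]: the digit [1] passes into the integer part. *)
Definition chang_mk n x : chang C :=
  match pselect (x = 1) with
  | left _ => ((n + 1)%R, exist _ 0 (@chain_neq01 C))
  | right h => (n, exist _ x h)
  end.

(** When the digits add up to [1], the remainder after the carry is [x ⊙ y]. *)
Definition chang_carry n x m y : chang C :=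
  if pselect (x ⊕ y = 1) then chang_mk (n + m + 1)%R (x ⊙ y)
  else chang_mk (n + m)%R (x ⊕ y).

Definition chang_add g h : chang C :=
  chang_carry g.1 (sval g.2) h.1 (sval h.2).

(** This follows [-(n + x) = (-n - 1) + (1 - x)]. *)
Definition chang_opp g : chang C := chang_mk (- g.1 - 1)%R (¬ sval g.2).

Lemma chang_mk1 n : chang_mk n 1 = chang_mk (n + 1)%R 0.
Proof.
rewrite /chang_mk; case: pselect => // _.
by case: pselect => [/chain_neq01//|h]; congr pair; exact: eq_exist.
Qed.

Lemma chang_mkN1 n x (h : x <> 1) : chang_mk n x = (n, exist _ x h).
Proof.
by rewrite /chang_mk; case: pselect => // h'; congr pair; exact: eq_exist.
Qed.

Lemma chang_mkP g : exists n x, g = chang_mk n x /\ x <> 1.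
Proof. by case: g => n [x h]; exists n, x; rewrite (chang_mkN1 n h). Qed.

Lemma chang_carryC n x m y : chang_carry n x m y = chang_carry m y n x.
Proof. by rewrite /chang_carry (mvDC x) (mvMC x) (addrC n). Qed.

(** Digits may be normalized before or after adding; only a digit [1] needs a check, done in
    [carry1]. *)
Lemma chang_add_mk n x m y :
  chang_add (chang_mk n x) (chang_mk m y) = chang_carry n x m y.
Proof.
have carry1 k t l s : t = 1 -> chang_carry (k + 1)%R 0 l s = chang_carry k t l s.
  move=> ->; rewrite /chang_carry mv0D mv1D mv0M mv1M.
  case: pselect => [s1|_] /=; case: pselect => // _ /=.
    by rewrite s1 chang_mk1; congr chang_mk; lia.
  by congr chang_mk; lia.
rewrite /chang_add {1 2}/chang_mk {1 2}/chang_mk.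
case: pselect => x1; case: pselect => y1 //=; rewrite ?(carry1 _ x)//.
  by rewrite chang_carryC (carry1 _ y)// chang_carryC.
by rewrite chang_carryC (carry1 _ y)// chang_carryC.
Qed.

(** Totality enters here: the alternative [¬ y ⊑ x] says exactly that the digits carry. *)
Lemma chain_carry x y : x ⊕ y <> 1 -> x ⊑ ¬ y.
Proof.
move=> xy; have [//|yx] := chain_total x (¬ y).
by case: xy; move: yx; rewrite /mv_le mvNK mvDC.
Qed.

Lemma chang_addC : commutative chang_add.
Proof. by move=> g h; rewrite /chang_add chang_carryC. Qed.

(** There are four cases, according to whether [x ⊕ y] and [y ⊕ z] carry; commutativity exchanges
    the two mixed ones, so [half] settles both. *)
Lemma chang_addA : associative chang_add.
Proof.
have half n x m y k z : x ⊕ y = 1 -> y ⊕ z <> 1 ->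
    chang_add (chang_add (chang_mk n x) (chang_mk m y)) (chang_mk k z) =
    chang_add (chang_mk n x) (chang_add (chang_mk m y) (chang_mk k z)).
  move=> xy yz; rewrite !chang_add_mk [chang_carry _ x _ y]/chang_carry.
  rewrite [chang_carry _ y _ z]/chang_carry.
  case: pselect => //= _; case: pselect => //= _.
  rewrite !chang_add_mk /chang_carry (mv_mulD_assoc xy (chain_carry yz)).
  case: pselect => [h|_] /=.
    case: yz; apply: mv_le_anti; first exact: mv_le1.
    by rewrite -h; exact: mv_leMr.
  case: pselect => /= [_|[]]; last by rewrite mvDA xy mv1D.
  by congr chang_mk; lia.
move=> g h l; have [n [x [-> x1]]] := chang_mkP g.
have [m [y [-> y1]]] := chang_mkP h; have [k [z [-> z1]]] := chang_mkP l.
have [xy|xy] := pselect (x ⊕ y = 1); have [yz|yz] := pselect (y ⊕ z = 1).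
- rewrite !chang_add_mk /chang_carry; case: pselect => //= _.
  case: pselect => //= _; rewrite !chang_add_mk /chang_carry.
  rewrite (mv_mulD_swap xy yz) mvMA.
  by case: pselect => /= _; congr chang_mk; lia.
- by rewrite half.
- rewrite chang_addC (chang_addC (chang_mk m y)) half; last 2 first.
  + by rewrite mvDC.
  + by rewrite mvDC.
  by rewrite chang_addC (chang_addC (chang_mk n x)).
- rewrite !chang_add_mk /chang_carry; case: pselect => //= _.
  case: pselect => //= _; rewrite !chang_add_mk /chang_carry mvDA.
  (* With no carry on either side, the complements carry, and [mv_mulD_swap] for them is the dual of
     this identity. *)
  have -> : x ⊙ (y ⊕ z) = (x ⊕ y) ⊙ z.
    have := mv_mulD_swap (chain_carry xy) (chain_carry yz).
    by rewrite /mvM !mvNK => ->.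
  by case: pselect => /= _; congr chang_mk; lia.
Qed.

Lemma chang_add0 : left_id (chang_mk 0%R 0) chang_add.
Proof.
move=> g; have [n [x [-> x1]]] := chang_mkP g.
rewrite chang_add_mk /chang_carry mv0D; case: pselect => //= _.
by congr chang_mk; lia.
Qed.

Lemma chang_addN : left_inverse (chang_mk 0%R 0) chang_opp chang_add.
Proof.
move=> [n [x x1]]; rewrite /chang_opp /= -chang_mkN1 chang_add_mk /chang_carry /=.
case: pselect => /= [_|[]]; last exact: mvND.
by rewrite mvMC mvMN; congr chang_mk; lia.
Qed.

HB.instance Definition _ := GRing.isZmodule.Build (chang C)
  chang_addA chang_addC chang_add0 chang_addN.

(** Digits are never negative, so the sign is that of the integer part. *)
Definition chang_pos : set (chang C) := [set g | (0 <= g.1)%R].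
Definition chang_embed x : chang C := chang_mk 0%R x.

Local Open Scope ring_scope.
Local Notation γ := chang_embed.

Lemma chang_mk_pos n x : 0 <= n -> chang_pos (chang_mk n x).
Proof. by rewrite /chang_pos /chang_mk; case: pselect => /=; lia. Qed.

Lemma chang_pos0 : chang_pos 0.
Proof. exact: chang_mk_pos. Qed.

Lemma chang_posD g h : chang_pos g -> chang_pos h -> chang_pos (g + h).
Proof.
rewrite {1 2}/chang_pos /= => g0 h0; rewrite /GRing.add /= /chang_add.
by rewrite /chang_carry; case: pselect => /= _; apply: chang_mk_pos; lia.
Qed.

Lemma chang_pos_total g : chang_pos g \/ chang_pos (- g).
Proof.
have [g0|g0] := lerP 0 g.1; [by left|right].
by apply: chang_mk_pos; lia.
Qed.

Lemma chang_embed_pos x : chang_pos (γ x).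
Proof. exact: chang_mk_pos. Qed.

(** The integer part of [- γ x] is [-1]; [x = 1] is treated apart because its normal form is not
    [(0, x)]. This strictness is what [local_real_hom] asks of [d]. *)
Lemma chang_embed_Npos x : x <> 0%mv -> ~ chang_pos (- γ x).
Proof.
move=> x0; have [->|x1] := pselect (x = 1%mv).
  rewrite /chang_embed chang_mk1 (chang_mkN1 _ (@chain_neq01 C)).
  rewrite /GRing.opp /= /chang_opp /= chang_mk1 (chang_mkN1 _ (@chain_neq01 C)).
  by rewrite /chang_pos /=; lia.
have Nx1 : (¬ x)%mv <> 1%mv by move=> /(congr1 mvN); rewrite !mvNK.
rewrite /chang_embed (chang_mkN1 _ x1) /GRing.opp /= /chang_opp /=.
by rewrite (chang_mkN1 _ Nx1) /chang_pos /=; lia.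
Qed.

Lemma chang_embed0 : γ 0%mv = 0. Proof. by []. Qed.

Lemma chang_embedD x y : (x ⊕ y)%mv <> 1%mv -> γ (x ⊕ y)%mv = γ x + γ y.
Proof.
move=> xy; rewrite /GRing.add /= chang_add_mk /chang_carry.
by case: pselect => //= _; congr chang_mk; lia.
Qed.

Lemma chang_embed_carry x y :
  (x ⊕ y)%mv = 1%mv -> γ x + γ y = γ 1%mv + γ (x ⊙ y)%mv.
Proof.
move=> xy; rewrite /GRing.add /= !chang_add_mk /chang_carry mv1M mv1D xy.
by case: pselect.
Qed.

Lemma chang_embedN x : γ x + γ (¬ x)%mv = γ 1%mv.
Proof. by rewrite chang_embed_carry ?mvDN// mvMN chang_embed0 addr0. Qed.

(** Writing [y] as [x ⊕ y ⊙ ¬ x] involves no carry unless [y] is [1], where the carry leaves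
    remainder [0]. *)
Lemma chang_embedB x y : (x ⊑ y)%mv -> γ y = γ x + γ (y ⊙ ¬ x)%mv.
Proof.
move=> xy; have [->|y1] := pselect (y = 1%mv).
  by rewrite mv1M chang_embedN.
have yE : y = (x ⊕ y ⊙ ¬ x)%mv by rewrite mvDC mv_le_subDK.
by rewrite -chang_embedD -yE.
Qed.

End Chang.

(** * Fourier-Motzkin elimination *)

Local Open Scope ring_scope.

(** Integer coefficients allow the same form to be evaluated in the group and in the field. The
    variables are numbered from [0] to [n]. *)
Definition lform (V : zmodType) n (f : nat -> int) (g : nat -> V) : V :=
  \sum_(i < n.+1) g i *~ f i.

Section LinearForm.
Variables (V : zmodType) (n : nat).
Implicit Types (f h : nat -> int) (g : nat -> V).

Lemma lformD f h g : lform n (fun i => f i + h i) g = lform n f g + lform n h g.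
Proof. by rewrite -big_split; apply: eq_bigr => i _; rewrite mulrzDr. Qed.

Lemma lformZ f c g : lform n (fun i => f i * c) g = lform n f g *~ c.
Proof.
by rewrite /lform mulrz_suml; apply: eq_bigr => i _; rewrite mulrzA.
Qed.

Lemma lform_delta k g : (k <= n)%N -> lform n (fun i => (i == k)%:R) g = g k.
Proof.
move=> kn; rewrite /lform (bigD1 (inord k)) //= inordK // eqxx mulr1z.
rewrite big1 ?addr0 // => i /eqP ik; case: eqP => [iE|]; last by rewrite mulr0z.
by case: ik; rewrite -iE inord_val.
Qed.

Lemma lform_recr f g : lform n.+1 f g = lform n f g + g n.+1 *~ f n.+1.
Proof. by rewrite /lform big_ord_recr. Qed.

Lemma eq_lform f g g' : (forall i, (i <= n)%N -> g i = g' i) ->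
  lform n f g = lform n f g'.
Proof. by move=> gg'; apply: eq_bigr => i _; rewrite gg'// -ltnS. Qed.

End LinearForm.

(** This supplies the value of an eliminated variable from its lower bounds [s] and upper bounds
    [t], either of which may be empty. *)
Lemma seq_sandwich (R : realFieldType) (s t : seq R) :
  (forall a b, a \in s -> b \in t -> a <= b) ->
  exists c, (forall a, a \in s -> a <= c) /\ (forall b, b \in t -> c <= b).
Proof.
elim: s => [_|a s IH st].
  elim: t => [|b t [c [_ ct]]]; first by exists 0.
  exists (Num.min b c); split=> // x; rewrite inE => /orP[/eqP->|/ct cx].
    by rewrite ge_min lexx.
  by rewrite ge_min cx orbT.
have [x y xs yt|c [sc ct]] := IH; first by apply: st => //; rewrite inE xs orbT.
exists (Num.max a c); split=> x.
  by rewrite inE le_max => /orP[/eqP->|/sc->]; rewrite ?lexx ?orbT.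
by move=> xt; rewrite ge_max ct// andbT st// inE eqxx.
Qed.

Record is_total_cone (G : zmodType) (P : set G) : Prop := {
  cone0 : P 0;
  coneD : forall a b, P a -> P b -> P (a + b);
  cone_total : forall a, P a \/ P (- a)
}.

Section FourierMotzkin.
Variables (R : realFieldType) (G : zmodType) (P : set G).
Hypothesis hP : is_total_cone P.

Lemma coneMz a c : P a -> 0 <= c -> P (a *~ c).
Proof.
move=> Pa; case: c => // n _; rewrite -pmulrn; elim: n => [|n IH].
  by rewrite mulr0n; exact: cone0.
by rewrite mulrS; exact: coneD.
Qed.

(* [r 0 = 1] is the only strict constraint; as variable [0] is never eliminated,
   all the others can be nonstrict. *)
Lemma fourier_motzkin n (g : nat -> G) (L : seq (nat -> int)) :
  ~ P (- g 0) -> (forall f, f \in L -> P (lform n f g)) ->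
  exists r : nat -> R, r 0 = 1 /\ forall f, f \in L -> 0 <= lform n f r.
Proof.
move=> g0; elim: n L => [|n IH] L LP.
  exists (fun=> 1); split=> // f /LP; rewrite /lform !big_ord1 /=.
  have [f0 _|f0 Pf] := lerP 0 (f 0%N); first by rewrite ler0z.
  have Pg : P (g 0%N) by case: (cone_total hP (g 0%N)) => // /g0.
  case: g0.
  (* A negative coefficient [f 0] would be fatal: adding [- f 0 - 1] copies of [g 0] to [f 0] copies
     leaves [- g 0] in the cone. *)
  have := coneD hP Pf (coneMz Pg (_ : 0 <= - f 0%N - 1)).
  by rewrite -mulrzDr addrA subrr add0r mulrN1z; apply; lia.
pose k := n.+1.
(* For [f k > 0 > h k] this is a combination with positive factors in which variable [k] cancels. *)
pose comb (f h : nat -> int) := fun i => f i * (- h k) + h i * f k.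
pose L0 := [seq f <- L | f k == 0].
pose Lp := [seq f <- L | 0 < f k].
pose Lm := [seq f <- L | f k < 0].
have combE (V : zmodType) (v : nat -> V) f h :
    lform n (comb f h) v = lform k f v *~ (- h k) + lform k h v *~ f k.
  rewrite -!lformZ -lformD lform_recr.
  suff -> : f k * - h k + h k * f k = 0 by rewrite mulr0z addr0.
  by lia.
have [f|r [r0 rL]] := IH (L0 ++ [seq comb f h | f <- Lp, h <- Lm]).
  rewrite mem_cat => /orP[|/allpairsP[[f1 f2] /= []]].
    rewrite mem_filter => /andP[/eqP fk /LP].
    by rewrite lform_recr fk mulr0z addr0.
  rewrite !mem_filter => /andP[f1k /LP Pf1] /andP[f2k /LP Pf2] ->.
  by rewrite combE; apply: (coneD hP); apply: coneMz => //; lia.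
(* The value of variable [k] at which [f] vanishes: a lower bound for [f] in [Lp], an upper bound
   for [f] in [Lm]. *)
pose bound (f : nat -> int) := - lform n f r / (f k)%:~R.
have [a b|c [cp cm]] := @seq_sandwich R (map bound Lp) (map bound Lm).
  move=> /mapP[f fLp ->] /mapP[h hLm ->].
  have := rL (comb f h); rewrite mem_cat (allpairs_f comb fLp hLm) orbT.
  move=> /(_ isT); rewrite /comb lformD !lformZ /bound.
  move: fLp hLm; rewrite !mem_filter => /andP[fk _] /andP[hk _].
  rewrite -(mulrzr (lform n f r)) -(mulrzr (lform n h r)) mulrNz => H.
  have fk' : (0 : R) < (f k)%:~R by rewrite ltr0z.
  have hk' : (h k)%:~R < (0 : R) by rewrite ltrz0.
  rewrite ler_pdivrMr// mulrAC ler_ndivlMr//; lra.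
pose r' i := if i == k then c else r i.
have r'E f : lform k f r' = lform n f r + c * (f k)%:~R.
  rewrite lform_recr /r' eqxx mulrzr; congr (_ + _).
  by apply: eq_lform => i ik; case: eqP => // ?; lia.
exists r'; split=> // f fL; rewrite r'E.
have [fk|fk|fk] := ltrgtP (f k) 0.
- have fk' : (f k)%:~R < (0 : R) by rewrite ltrz0.
  have /cm : bound f \in map bound Lm by rewrite map_f// mem_filter fk.
  by rewrite /bound ler_ndivlMr//; lra.
- have fk' : (0 : R) < (f k)%:~R by rewrite ltr0z.
  have /cp : bound f \in map bound Lp by rewrite map_f// mem_filter fk.
  by rewrite /bound ler_pdivrMr//; lra.
- rewrite fk mulr0 addr0; apply: rL.
  by rewrite mem_cat mem_filter fk eqxx fL.
Qed.

(** The values of [r] solve a finite linear system with a variable for each of [d], the elements of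
    [F] and their pairwise sums. The group elements themselves satisfy it in [G], so
    [fourier_motzkin] yields a real solution. *)
Lemma local_real_hom (F : seq G) (d : G) : ~ P (- d) ->
  exists r : G -> R, [/\ 0 < r d,
    forall a b, a \in F -> b \in F -> r (a + b) = r a + r b &
    forall a, a \in F -> P a -> 0 <= r a].
Proof.
move=> Pd.
(* Placing [d] first makes it variable [0], the one that gets the value [1]. *)
pose E := d :: F ++ [seq a + b | a <- F, b <- F].
pose g := nth 0 E.
pose idx a := index a E.
pose dl a : nat -> int := fun i => (i == idx a)%:R.
pose add_form a b := fun i => dl (a + b) i + (dl a i + dl b i) * (-1).
(* Each additivity equation is stated as two opposite inequalities. *)
pose L := [seq add_form a b | a <- F, b <- F] ++
  [seq (fun i => f i * (-1)) | f <- [seq add_form a b | a <- F, b <- F]] ++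
  [seq dl a | a <- F & `[< P a >]].
pose n := (size E).-1.
have dlE (V : zmodType) (v : nat -> V) a : a \in E -> lform n (dl a) v = v (idx a).
  by move=> aE; rewrite lform_delta// /n /= -ltnS; rewrite -index_mem in aE.
have FE a : a \in F -> a \in E by rewrite inE mem_cat => ->; rewrite orbT.
have DE a b : a \in F -> b \in F -> a + b \in E.
  by move=> aF bF; rewrite inE mem_cat (allpairs_f _ aF bF) !orbT.
have gE a : a \in E -> g (idx a) = a by move=> aE; rewrite /g nth_index.
have addE (V : zmodType) (v : nat -> V) a b : a \in F -> b \in F ->
    lform n (add_form a b) v = v (idx (a + b)) - (v (idx a) + v (idx b)).
  by move=> aF bF; rewrite lformD lformZ lformD !dlE ?DE ?FE//.
have [//|f|r [r0 rL]] := @fourier_motzkin n g L.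
  rewrite !mem_cat => /or3P[/allpairsP[[a b] /= [aF bF ->]]||].
  - by rewrite addE// !gE ?DE ?FE// subrr; exact: cone0.
  - move=> /mapP[_ /allpairsP[[a b] /= [aF bF ->]] ->].
    by rewrite lformZ addE// !gE ?DE ?FE// subrr mul0rz; exact: cone0.
  - move=> /mapP[a]; rewrite mem_filter => /andP[/asboolP Pa aF] ->.
    by rewrite dlE ?gE ?FE.
exists (fun a => r (idx a)); split.
- by rewrite /idx /= eqxx r0 ltr01.
- move=> a b aF bF; have h := allpairs_f add_form aF bF.
  have := rL (add_form a b); rewrite mem_cat h => /(_ isT); rewrite addE//.
  have := rL (fun i => add_form a b i * (-1)); rewrite !mem_cat map_f// orbT.
  by move=> /(_ isT); rewrite lformZ addE// mulrN1z; lra.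
- move=> a aF Pa; rewrite -(dlE _ r) ?FE//; apply: rL; rewrite !mem_cat.
  by rewrite (map_f dl) ?orbT// mem_filter aF andbT; apply/asboolP.
Qed.

End FourierMotzkin.

(** * The center of an IMV-algebra *)

Section Center.
Variables (A : algebra) (hA : is_IMV A).
Implicit Types x y : A.

Lemma imv_deltaN x : delta (neg x) = neg (nabla x).
Proof. by rewrite (imv_nablaE hA) (imv_negK hA). Qed.

Lemma imv_nablaN x : nabla (neg x) = neg (delta x).
Proof. by rewrite (imv_nablaE hA) (imv_negK hA). Qed.

Lemma imv_nabla_delta x : nabla (delta x) = delta x.
Proof.
rewrite (imv_nablaE hA) -(imv_nablaN x) (imv_delta_nabla hA) imv_nablaN.
by rewrite (imv_negK hA).
Qed.

(** The De Morgan dual of [imv_delta_odot]. *)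
Lemma imv_nabla_oplus x y : nabla (oplus x y) = oplus (nabla x) (nabla y).
Proof.
have -> : oplus x y = neg (odot (neg x) (neg y)).
  by rewrite (imv_odotE hA) !(imv_negK hA).
rewrite imv_nablaN (imv_delta_odot hA) (imv_odotE hA) !imv_deltaN.
by rewrite !(imv_negK hA).
Qed.

Lemma imv_nabla0 : nabla zero = zero :> A.
Proof.
rewrite (imv_nablaE hA) -(imv_oneE hA) (imv_delta1 hA) (imv_oneE hA).
by rewrite (imv_negK hA).
Qed.

Lemma imv_nabla_iota : nabla ciota = neg zero :> A.
Proof.
by rewrite (imv_nablaE hA) (imv_neg_iota hA) (imv_delta_iota hA).
Qed.

Lemma imv_ext x y : delta x = delta y -> nabla x = nabla y -> x = y.
Proof.
by move=> dxy nxy; rewrite -(imv_decomp hA x) -(imv_decomp hA y) dxy nxy.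
Qed.

Definition center := {x : A | delta x = x}.

Lemma center_deltaP x : delta (delta x) = delta x.
Proof. exact: imv_delta_delta. Qed.
Lemma center_nablaP x : delta (nabla x) = nabla x.
Proof. exact: imv_delta_nabla. Qed.
Lemma center_negP x : delta x = x -> delta (neg x) = neg x.
Proof. by move=> <-; rewrite imv_deltaN imv_nabla_delta. Qed.
Lemma center_oplusP x y : delta x = x -> delta y = y ->
  delta (oplus x y) = oplus x y.
Proof. by move=> xE yE; rewrite (imv_delta_oplus hA) xE yE. Qed.

Definition center_delta x : center := exist _ _ (center_deltaP x).
Definition center_nabla x : center := exist _ _ (center_nablaP x).
Definition center0 : center := exist _ _ (imv_delta0 hA).
Definition centerN (p : center) : center := exist _ _ (center_negP (svalP p)).
Definition centerD (p q : center) : center :=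
  exist _ _ (center_oplusP (svalP p) (svalP q)).

Lemma centerDA : associative centerD.
Proof. by move=> p q r; apply: eq_exist; rewrite /= (imv_oplusA hA). Qed.
Lemma centerDC : commutative centerD.
Proof. by move=> p q; apply: eq_exist; rewrite /= (imv_oplusC hA). Qed.
Lemma centerD0 : right_id center0 centerD.
Proof. by move=> [x xE]; apply: eq_exist; rewrite /= (imv_oplus0 hA). Qed.
Lemma centerD1 : right_zero (centerN center0) centerD.
Proof. by move=> p; apply: eq_exist; rewrite /= (imv_oplusN0 hA). Qed.
Lemma centerNK : involutive centerN.
Proof. by move=> [x xE]; apply: eq_exist; rewrite /= (imv_negK hA). Qed.
Lemma centerDNC p q : centerD (centerN (centerD (centerN p) q)) q =
  centerD (centerN (centerD (centerN q) p)) p.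
Proof.
case: p q => [x xE] [y yE]; apply: eq_exist => /=.
by have := imv_lukasiewicz hA x y; rewrite xE yE.
Qed.

Definition center_mv : mv :=
  MV centerDA centerDC centerD0 centerD1 centerNK centerDNC.

End Center.

(* [lo] and [hi] play the roles of [Δ] and [∇], followed by a homomorphism from
   the MV-algebra of fixed points of [Δ] to [M]. *)
Record is_bounds_map (A : algebra) (M : mv) (lo hi : A -> M) : Prop := {
  lo_zero : lo zero = 0%mv;
  hi_zero : hi zero = 0%mv;
  lo_iota : lo ciota = 0%mv;
  hi_iota : hi ciota = 1%mv;
  lo_neg : forall x, lo (neg x) = (¬ hi x)%mv;
  hi_neg : forall x, hi (neg x) = (¬ lo x)%mv;
  lo_delta : forall x, lo (delta x) = lo x;
  hi_delta : forall x, hi (delta x) = lo x;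
  lo_oplus : forall x y, lo (oplus x y) = (lo x ⊕ lo y)%mv;
  hi_oplus : forall x y, hi (oplus x y) = (hi x ⊕ hi y)%mv;
  lo_le_hi : forall x, (lo x ⊑ hi x)%mv
}.

Lemma center_bounds_map (A : algebra) (hA : is_IMV A) (M : mv)
    (h : center_mv hA -> M) : is_mv_hom h ->
  is_bounds_map (fun x => h (center_delta hA x)) (fun x => h (center_nabla hA x)).
Proof.
move=> hh; split=> [||||x|x|x|x|x y|x y|x].
- rewrite -(mv_hom0 hh); congr h; apply: eq_exist; exact: imv_delta0.
- rewrite -(mv_hom0 hh); congr h; apply: eq_exist; exact: imv_nabla0.
- rewrite -(mv_hom0 hh); congr h; apply: eq_exist; exact: imv_delta_iota.
- rewrite -(mv_hom0 hh) -(mv_homN hh); congr h; apply: eq_exist.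
  exact: imv_nabla_iota.
- rewrite -(mv_homN hh); congr h; apply: eq_exist; exact: imv_deltaN.
- rewrite -(mv_homN hh); congr h; apply: eq_exist; exact: imv_nablaN.
- congr h; apply: eq_exist; exact: imv_delta_delta.
- congr h; apply: eq_exist; exact: imv_nabla_delta.
- rewrite -(mv_homD hh); congr h; apply: eq_exist; exact: imv_delta_oplus.
- rewrite -(mv_homD hh); congr h; apply: eq_exist; exact: imv_nabla_oplus.
- apply/(mv_hom_le hh)/mv_le_diff; apply: eq_exist => /=.
  by rewrite -(imv_odotE hA) (imv_delta_nabla0 hA).
Qed.

(** By [imv_ext], [a] and [b] differ under [delta] or under [nabla], hence at two points of the
    center; one of the truncated differences of these points is nonzero and survives in a chain. *)
Lemma imv_chain_separation (A : algebra) (a b : A) : is_IMV A -> a <> b ->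
  exists (C : mv_chain) (lo hi : A -> C), is_bounds_map lo hi /\
    (lo a <> lo b \/ hi a <> hi b).
Proof.
move=> hA ab.
have sep (p q : center_mv hA) : p <> q ->
    exists (C : mv_chain) (h : center_mv hA -> C), is_mv_hom h /\ h p <> h q.
  move=> pq; have [|] := pselect ((p ⊙ ¬ q)%mv = 0%mv); last first.
    move=> /mv_chain_separation[C [h [hh hpq]]]; exists C, h; split=> // E.
    by apply: hpq; rewrite (mv_homM hh) (mv_homN hh) E mvMN.
  have [|] := pselect ((q ⊙ ¬ p)%mv = 0%mv).
    by move=> /mv_le_diff qp /mv_le_diff pq'; case: pq; exact: mv_le_anti.
  move=> /mv_chain_separation[C [h [hh hpq]]] _; exists C, h; split=> // E.
  by apply: hpq; rewrite (mv_homM hh) (mv_homN hh) E mvMN.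
have [dab|dab] := pselect (delta a = delta b).
  have [|C [h [hh hab]]] := sep (center_nabla hA a) (center_nabla hA b).
    by move=> /(congr1 sval) /= /(imv_ext hA dab).
  exists C, (fun x => h (center_delta hA x)), (fun x => h (center_nabla hA x)).
  by split; [exact: center_bounds_map|right].
have [|C [h [hh hab]]] := sep (center_delta hA a) (center_delta hA b).
  by move=> /(congr1 sval).
exists C, (fun x => h (center_delta hA x)), (fun x => h (center_nabla hA x)).
by split; [exact: center_bounds_map|left].
Qed.

(** * The IMV axioms in [Theta R] *)

Section ThetaIMV.
Variable R : realType.

Lemma Theta_ext (p q : Theta R) : sval p = sval q -> p = q.
Proof. by case: p q => [p hp] [q hq] /= pq; exact: eq_exist. Qed.

Lemma Theta_bounds (p : Theta R) : bounds01 (sval p).1 (sval p).2.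
Proof. by case: p. Qed.


Ltac minmax_free t :=
  lazymatch t with
  | context [Order.min _ _] => fail
  | context [Order.max _ _] => fail
  | _ => idtac
  end.
(** Innermost occurrences are split first, so that the comparisons are linear; testing the second
    argument suffices because the first is the constant [0] or [1]. *)
Ltac minmax_lra := repeat match goal with
  | |- context [Order.min ?x ?y] => minmax_free y; case: (leP x y) => ?
  | |- context [Order.max ?x ?y] => minmax_free y; case: (leP x y) => ?
  end; lra.
Lemma Theta_IMV : is_IMV (Theta R).
Proof.
split; intros; apply: Theta_ext => /=; rewrite /mv_neg /mv_oplus /mv_odot;
  repeat match goal with
  | p : carrier (Theta R) |- _ =>
    have := Theta_bounds p; case: p => [[? ?] ?] /= /and3P[? ? ?]
  end; congr pair; minmax_lra.
Qed.
End ThetaIMV.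

(** * Varieties *)

Lemma is_IMV_inj (A B : algebra) (f : A -> B) :
  is_hom f -> injective f -> is_IMV B -> is_IMV A.
Proof.
case=> f0 f1 fi fN fd fn fD fM finj; case=> *.
by split=> *; apply: finj; rewrite !(f0, f1, fi, fN, fd, fn, fD, fM).
Qed.

Lemma is_IMV_surj (A B : algebra) (f : A -> B) :
  is_hom f -> (forall y, exists x, f x = y) -> is_IMV A -> is_IMV B.
Proof.
case=> f0 f1 fi fN fd fn fD fM fsurj.
have homE := (f0, f1, fi, fN, fd, fn, fD, fM).
case=> *; split; intros; repeat match goal with
  | y : carrier B |- _ => have [? ?] := fsurj y; subst y
  end; rewrite -?homE; congr f; auto.
Qed.

Lemma is_IMV_power (K : algebra) (I : Type) : is_IMV K -> is_IMV (power K I).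
Proof. by case=> *; split=> *; apply/funext => i /=; auto. Qed.

Lemma subalgebra_val_hom (B : algebra) (S : subuniverse B) :
  is_hom (sval : subalgebra S -> B).
Proof. by []. Qed.

Lemma subalgebra_val_inj (B : algebra) (S : subuniverse B) :
  injective (sval : subalgebra S -> B).
Proof. by move=> [x Sx] [y Sy] /= xy; exact: eq_exist. Qed.

Lemma HSP_IMV (K A : algebra) : is_IMV K -> HSP K A -> is_IMV A.
Proof.
move=> hK [I [S [f [hf fsurj]]]]; apply: (is_IMV_surj hf fsurj).
apply: (is_IMV_inj (@subalgebra_val_hom _ S)).
  exact: subalgebra_val_inj.
exact: is_IMV_power.
Qed.

Lemma eval_hom (A B : algebra) (f : A -> B) : is_hom f ->
  forall v t, f (eval v t) = eval (f \o v) t.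
Proof.
case=> f0 f1 fi fN fd fn fD fM v.
by elim=> //= *; rewrite ?(f0, f1, fi, fN, fd, fn, fD, fM); congruence.
Qed.

Lemma power_eval (K : algebra) (I : Type) (v : nat -> power K I) t (i : I) :
  eval v t i = eval (fun n => v n i) t.
Proof. by elim: t => //= *; congruence. Qed.

(** A valuation in [A] lifts along the surjection, and in the power the equation is checked
    coordinatewise. *)
Lemma HSP_satisfies (K A : algebra) s t :
  HSP K A -> satisfies K s t -> satisfies A s t.
Proof.
move=> [I [S [f [hf fsurj]]]] Kst v.
have [w wE] := choice (fun n => fsurj (v n)).
have -> : v = f \o w by apply/funext => n; rewrite /= wE.
rewrite -!(eval_hom hf); congr f; apply: subalgebra_val_inj.
rewrite !(eval_hom (@subalgebra_val_hom _ S)).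
by apply/funext => i; rewrite !power_eval.
Qed.

(** * Transport of [HSP] along an isomorphism *)

Section IsoHSP.
Variables (K L : algebra) (f : K -> L) (g : L -> K).
Hypotheses (hf : is_hom f) (fK : cancel f g) (gK : cancel g f).

Lemma iso_inv_hom : is_hom g.
Proof.
by case: hf => *; split=> *; apply: (can_inj fK); rewrite ?gK; congruence.
Qed.

Variables (I : Type) (S : subuniverse (power L I)).

Let fI : power K I -> power L I := fun x i => f (x i).

Lemma hom_power : is_hom fI.
Proof.
by case: hf => *; split=> *; apply/funext => i; rewrite /fI /=; auto.
Qed.

Definition preim_subuniverse : subuniverse (power K I).
Proof.
exists (fun x => S (fI x)).
- by rewrite (hom_zero hom_power); exact: sub_zero.
- by rewrite (hom_one hom_power); exact: sub_one.
- by rewrite (hom_iota hom_power); exact: sub_iota.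
- by move=> x; rewrite (hom_neg hom_power); exact: sub_neg.
- by move=> x; rewrite (hom_delta hom_power); exact: sub_delta.
- by move=> x; rewrite (hom_nabla hom_power); exact: sub_nabla.
- by move=> x y; rewrite (hom_oplus hom_power); exact: sub_oplus.
- by move=> x y; rewrite (hom_odot hom_power); exact: sub_odot.
Defined.

Definition preim_map (x : subalgebra preim_subuniverse) : subalgebra S :=
  exist _ (fI (sval x)) (svalP x).

Lemma preim_map_hom : is_hom preim_map.
Proof.
have [? ? ? ? ? ? ? ?] := hom_power.
by split=> *; apply: subalgebra_val_inj;
  match goal with h : _ |- _ => exact: h end.
Qed.

Lemma preim_map_surj y : exists x, preim_map x = y.
Proof.
have yE : fI (fun i => g (sval y i)) = sval y by apply/funext => i; exact: gK.
have Sy : preim_subuniverse (fun i => g (sval y i)).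
  by rewrite /= yE; exact: svalP.
by exists (exist _ _ Sy); apply: subalgebra_val_inj.
Qed.

End IsoHSP.

Lemma is_hom_comp (A B D : algebra) (f : A -> B) (g : B -> D) :
  is_hom f -> is_hom g -> is_hom (g \o f).
Proof.
by move=> [? ? ? ? ? ? ? ?] [? ? ? ? ? ? ? ?]; split=> * /=; congruence.
Qed.

Lemma HSP_iso (K L A : algebra) (f : K -> L) : is_iso f ->
  HSP L A -> HSP K A.
Proof.
move=> [hf [g fK gK]] [I [S [h [hh hsurj]]]].
exists I, (preim_subuniverse hf S), (h \o preim_map (S := S)); split.
  by apply: is_hom_comp => //; exact: preim_map_hom.
move=> y; have [x <-] := hsurj y.
by have [z <-] := preim_map_surj hf gK x; exists z.
Qed.

(** * The isomorphism [omega] *)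

Section Omega.
Variable R : realType.

Lemma I01P (x : I01 R) : exists a b (h : bounds01 a b), x = mk_interval01 h.
Proof.
case: x => X hX; have [a [b [h XE]]] := hX.
by exists a, b, h; apply: eq_exist; exact: XE.
Qed.

Lemma omegaE (a b : R) (h : bounds01 a b) : omega (mk_interval01 h) = mk_theta h.
Proof.
apply: Theta_ext => /=; have /and3P[_ ab _] := h.
by rewrite inf_itv ?bnd_simp// sup_itv ?bnd_simp.
Qed.

Lemma I01_ext (x y : I01 R) : sval x = sval y -> x = y.
Proof. by case: x y => [x hx] [y hy] /= xy; exact: eq_exist. Qed.

Lemma omega_iso : is_iso (@omega R).
Proof.
(* This reduces each operation to the endpoint formula for the corresponding operation on sets. *)
have opE (x : I01 R) (a b : R) (h : bounds01 a b) (p : Theta R) :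
    sval x = `[a, b]%classic -> sval p = (a, b) -> omega x = p.
  move=> xE pE; have -> : x = mk_interval01 h by exact: I01_ext.
  by rewrite omegaE; apply: Theta_ext.
split.
  split; rewrite ?omegaE//.
  - move=> x; have [a [b [h ->]]] := I01P x; rewrite omegaE.
    by apply: (opE _ _ _ (bounds01_neg h)) => //; exact: neg_setE.
  - move=> x; have [a [b [h ->]]] := I01P x; rewrite omegaE.
    by apply: (opE _ _ _ (bounds01_delta h)) => //; exact: delta_setE.
  - move=> x; have [a [b [h ->]]] := I01P x; rewrite omegaE.
    by apply: (opE _ _ _ (bounds01_nabla h)) => //; exact: nabla_setE.
  - move=> x y; have [a [b [h ->]]] := I01P x; have [c [d [k ->]]] := I01P y.
    rewrite !omegaE.
    by apply: (opE _ _ _ (bounds01_oplus h k)) => //; exact: oplus_setE.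
  - move=> x y; have [a [b [h ->]]] := I01P x; have [c [d [k ->]]] := I01P y.
    rewrite !omegaE.
    by apply: (opE _ _ _ (bounds01_odot h k)) => //; exact: odot_setE.
exists (fun p : Theta R => mk_interval01 (svalP p) : I01 R).
- move=> x; have [a [b [h ->]]] := I01P x; rewrite omegaE.
  exact: I01_ext.
- by move=> [[a b] h]; rewrite omegaE; exact: Theta_ext.
Qed.

End Omega.

Lemma is_iso_inv (K L : algebra) (f : K -> L) : is_iso f ->
  exists g : L -> K, is_iso g.
Proof.
move=> [hf [g fK gK]]; exists g; split; first exact: iso_inv_hom hf fK gK.
by exists f.
Qed.

(** * Completeness *)

Section LocalEmbedding.
Variables (R : realType) (A : algebra) (C : mv_chain) (lo hi : A -> C).
Hypothesis lohi : is_bounds_map lo hi.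
Local Notation γ := (@chang_embed C).
Implicit Types (r : chang C -> R) (F : seq (chang C)) (x y : C).

(** Positivity and additivity are available only on a finite list, so each identity below names the
    group elements on which it relies. *)
Definition local_hom F r : Prop :=
  (forall a b, a \in F -> b \in F -> r (a + b) = r a + r b) /\
  (forall a, a \in F -> chang_pos a -> 0 <= r a).

Lemma local_hom_cat F F' r :
  local_hom (F ++ F') r -> local_hom F r /\ local_hom F' r.
Proof.
move=> [rD rP]; split; split=> [a b aF bF|a aF]; first [apply: rD|apply: rP];
  by rewrite mem_cat ?aF ?bF ?orbT.
Qed.

Lemma chang_total_cone : is_total_cone (@chang_pos C).
Proof.
by split; [exact: chang_pos0|exact: chang_posD|exact: chang_pos_total].
Qed.

Definition normalized r x : R := r (γ x) / r (γ 1%mv).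

Lemma normalized1 r : 0 < r (γ 1%mv) -> normalized r 1%mv = 1.
Proof. by move=> r1; rewrite /normalized divff// gt_eqF. Qed.

Lemma normalized0 r : local_hom [:: γ 0%mv] r -> normalized r 0%mv = 0.
Proof.
move=> [rD _]; have := rD _ _ (mem_head _ _) (mem_head _ _).
by rewrite addr0 /normalized => E; rewrite (_ : r _ = 0) ?mul0r//; lra.
Qed.

Lemma local_hom_neg x r : local_hom [:: γ x; γ (¬ x)%mv] r ->
  r (γ 1%mv) = r (γ x) + r (γ (¬ x)%mv) /\ 0 <= r (γ x) /\ 0 <= r (γ (¬ x)%mv).
Proof.
move=> [rD rP]; rewrite -rD ?inE ?eqxx ?orbT// chang_embedN; split=> //.
by split; apply: rP; rewrite ?inE ?eqxx ?orbT//; exact: chang_embed_pos.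
Qed.

Lemma normalizedN x r : local_hom [:: γ x; γ (¬ x)%mv] r ->
  0 < r (γ 1%mv) -> normalized r (¬ x)%mv = 1 - normalized r x.
Proof.
move=> /local_hom_neg[rE _] r1; rewrite -[1 in RHS](normalized1 r1) /normalized.
by rewrite -mulrBl; congr (_ / _); rewrite rE; lra.
Qed.

Lemma local_hom_le x y r : (x ⊑ y)%mv ->
  local_hom [:: γ x; γ (y ⊙ ¬ x)%mv] r ->
  r (γ y) = r (γ x) + r (γ (y ⊙ ¬ x)%mv) /\ 0 <= r (γ (y ⊙ ¬ x)%mv).
Proof.
move=> xy [rD rP]; rewrite -rD ?inE ?eqxx ?orbT// -chang_embedB//; split=> //.
by apply: rP; rewrite ?inE ?eqxx ?orbT//; exact: chang_embed_pos.
Qed.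

(** If the sum carries, [r (γ x) + r (γ y)] exceeds [r (γ 1)] by the nonnegative [r (γ (x ⊙ y))], so
    the minimum is [1]. Otherwise the sum is exact, and nonnegativity at its complement keeps it at
    most [r (γ 1)]. *)
Lemma normalizedD x y r :
  local_hom [:: γ x; γ y; γ 1%mv; γ (x ⊙ y)%mv] r ->
  local_hom [:: γ (x ⊕ y)%mv; γ (¬ (x ⊕ y))%mv] r ->
  0 < r (γ 1%mv) ->
  normalized r (x ⊕ y)%mv = mv_oplus (normalized r x) (normalized r y).
Proof.
move=> [rD rP] /local_hom_neg[rE [rxy rNxy]] r1; rewrite /mv_oplus /normalized.
rewrite -mulrDl -rD ?inE ?eqxx ?orbT//.
have [xy1|xy1] := pselect ((x ⊕ y)%mv = 1%mv).
  rewrite xy1 chang_embed_carry// rD ?inE ?eqxx ?orbT//.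
  have r0 : 0 <= r (γ (x ⊙ y)%mv).
    by apply: rP (chang_embed_pos _); rewrite !inE eqxx !orbT.
  rewrite min_l; first by rewrite divff// gt_eqF.
  by rewrite ler_pdivlMr// mul1r lerDl.
rewrite -chang_embedD// min_r// ler_pdivrMr// mul1r rE; lra.
Qed.

(* The value outside [bounds01] is junk. *)
Definition theta_of (a b : R) : Theta R :=
  match @idP (bounds01 a b) with
  | ReflectT h => mk_theta h
  | ReflectF _ => zero
  end.

Lemma theta_ofE a b : bounds01 a b -> sval (theta_of a b) = (a, b).
Proof. by rewrite /theta_of; case: {-}_ / idP. Qed.

Definition real_valuation r (a : A) : Theta R :=
  theta_of (normalized r (lo a)) (normalized r (hi a)).

Lemma real_valuationE a r :
  local_hom [:: γ (lo a); γ (hi a ⊙ ¬ lo a)%mv] r ->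
  local_hom [:: γ (lo a); γ (¬ lo a)%mv] r ->
  local_hom [:: γ (hi a); γ (¬ hi a)%mv] r -> 0 < r (γ 1%mv) ->
  sval (real_valuation r a) = (normalized r (lo a), normalized r (hi a)).
Proof.
move=> /(local_hom_le (lo_le_hi lohi a))[E E0] /local_hom_neg[El [l0 l1]].
move=> /local_hom_neg[Eh [h0 h1]] r1; apply: theta_ofE; apply/and3P; split.
- by apply: divr_ge0 => //; exact: ltW.
- by rewrite /normalized ler_pM2r ?invr_gt0//; lra.
- by rewrite /normalized ler_pdivrMr// mul1r; lra.
Qed.

(** By totality the points are comparable, say [u ⊑ v]; the strictly positive element is then the
    embedded difference [v ⊙ ¬ u], whose value is the gap between those of [u] and [v]. *)
Lemma local_hom_separation F x y : x <> y ->
  exists r, [/\ local_hom F r, 0 < r (γ 1%mv) &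
    normalized r x <> normalized r y].
Proof.
have main u v : (u ⊑ v)%mv -> u <> v -> exists r, [/\ local_hom F r,
    0 < r (γ 1%mv) & normalized r u <> normalized r v].
  move=> uv neq; pose e := (v ⊙ ¬ u)%mv.
  have e0 : e <> 0%mv by move=> /mv_le_diff vu; apply: neq; exact: mv_le_anti.
  have [r [rd rD rP]] := local_real_hom R chang_total_cone
    (F ++ [:: γ u; γ e] ++ [:: γ e; γ (¬ e)%mv]) (chang_embed_Npos e0).
  have /local_hom_cat[rF /local_hom_cat[ruv /local_hom_neg[rE [_ re]]]] :
    local_hom (F ++ [:: γ u; γ e] ++ [:: γ e; γ (¬ e)%mv]) r by [].
  (* The elements [e] and [¬ e] were listed for this: their values add up to that of [1]. *)
  have r1 : 0 < r (γ 1%mv) by rewrite rE; lra.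
  have [rv _] := local_hom_le uv ruv.
  exists r; split=> //; rewrite /normalized => /mulIf.
  by rewrite invr_eq0 gt_eqF// => /(_ isT); rewrite rv -/e; lra.
move=> xy; have [le|le] := chain_total x y; first exact: main.
by have [|r [? ? h]] := main _ _ le; [exact: nesym|exists r; split=> // /esym].
Qed.

(** The list [F] is fixed before [r], so the lists for two elements can be concatenated and served
    by one [r]. *)
Definition tracks (t : (A -> Theta R) -> Theta R) (a : A) : Prop :=
  exists F, forall r, local_hom F r -> 0 < r (γ 1%mv) ->
    sval (t (real_valuation r)) = (normalized r (lo a), normalized r (hi a)).

End LocalEmbedding.

(** * The algebra generated by the projections *)

Section Free.
Variables (R : realType) (A : algebra).
Local Notation T := (Theta R).

(* The graph of the map from the algebra generated by the projections in the
   power onto [A]; [one], [nabla] and [odot] are definable from the rest. *)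
Inductive free_graph : power T (A -> T) -> A -> Prop :=
| free_var a : free_graph (fun w => w a) a
| free_zero : free_graph zero zero
| free_iota : free_graph ciota ciota
| free_neg x a : free_graph x a -> free_graph (neg x) (neg a)
| free_delta x a : free_graph x a -> free_graph (delta x) (delta a)
| free_oplus x a y b : free_graph x a -> free_graph y b ->
    free_graph (oplus x y) (oplus a b).

(** Along a derivation, [F] collects the group elements needed by the [normalized] identity of each
    rule. *)
Lemma free_graph_tracks (C : mv_chain) (lo hi : A -> C) :
  is_bounds_map lo hi ->
  forall x a, free_graph x a -> tracks lo hi x a.
Proof.
move=> lohi x a; set γ := @chang_embed C.
elim=> {x a} [a|||x a _ [F IH]|x a _ [F IH]|x a y b _ [F IHx] _ [F' IHy]].
- exists ([:: γ (lo a); γ (hi a ⊙ ¬ lo a)%mv] ++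
    ([:: γ (lo a); γ (¬ lo a)%mv] ++ [:: γ (hi a); γ (¬ hi a)%mv])) => r.
  move=> /local_hom_cat[h1 /local_hom_cat[h2 h3]].
  exact: real_valuationE.
- exists [:: γ 0%mv] => r /normalized0 r0 _.
  by rewrite (lo_zero lohi) (hi_zero lohi) r0.
- exists [:: γ 0%mv] => r /normalized0 r0 r1.
  by rewrite (lo_iota lohi) (hi_iota lohi) r0 normalized1.
- exists (F ++ ([:: γ (lo a); γ (¬ lo a)%mv] ++ [:: γ (hi a); γ (¬ hi a)%mv])).
  move=> r /local_hom_cat[h1 /local_hom_cat[h2 h3]] r1.
  by rewrite (lo_neg lohi) (hi_neg lohi) !normalizedN//= (IH r).
- exists F => r h r1.
  by rewrite (lo_delta lohi) (hi_delta lohi) /= (IH r).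
- pose s (f : A -> C) := [:: γ (f a); γ (f b); γ 1%mv; γ (f a ⊙ f b)%mv] ++
    [:: γ (f a ⊕ f b)%mv; γ (¬ (f a ⊕ f b))%mv].
  exists ((F ++ F') ++ (s lo ++ s hi)) => r.
  move=> /local_hom_cat[/local_hom_cat[h h'] /local_hom_cat[hlo hhi]] r1.
  have [l1 l2] := local_hom_cat hlo; have [u1 u2] := local_hom_cat hhi.
  by rewrite (lo_oplus lohi) (hi_oplus lohi) !normalizedD//= (IHx r)// (IHy r).
Qed.

Hypothesis hA : is_IMV A.

(** If [a] and [b] differed, some chain and then some [r] additive on both lists would separate
    their bounds; yet at the valuation given by [r], the single element [x] has to return both pairs
    of bounds. *)
Lemma free_graph_functional x a b : free_graph x a -> free_graph x b -> a = b.
Proof.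
move=> xa xb; apply: contrapT => /(imv_chain_separation hA).
move=> [C [lo [hi [lohi neq]]]].
have [F Fa] := free_graph_tracks lohi xa.
have [F' Fb] := free_graph_tracks lohi xb.
case: neq => /(local_hom_separation R (F ++ F')).
  move=> [r [/local_hom_cat[h h'] r1]]; apply.
  by have := Fa r h r1; rewrite (Fb r h' r1) => -[].
move=> [r [/local_hom_cat[h h'] r1]]; apply.
by have := Fa r h r1; rewrite (Fb r h' r1) => -[].
Qed.

Let hT := is_IMV_power (A -> T) (Theta_IMV R).

Lemma free_one : free_graph one one.
Proof. by rewrite (imv_oneE hT) (imv_oneE hA); exact/free_neg/free_zero. Qed.

Lemma free_nabla x a : free_graph x a -> free_graph (nabla x) (nabla a).
Proof.
rewrite (imv_nablaE hT) (imv_nablaE hA) => xa.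
exact/free_neg/free_delta/free_neg.
Qed.

Lemma free_odot x a y b : free_graph x a -> free_graph y b ->
  free_graph (odot x y) (odot a b).
Proof.
rewrite (imv_odotE hT) (imv_odotE hA) => xa yb.
by apply/free_neg/free_oplus; exact: free_neg.
Qed.

Definition free_subuniverse : subuniverse (power T (A -> T)).
Proof.
exists (fun x => exists a, free_graph x a).
- by exists zero; exact: free_zero.
- by exists one; exact: free_one.
- by exists ciota; exact: free_iota.
- by move=> x [a xa]; exists (neg a); exact: free_neg.
- by move=> x [a xa]; exists (delta a); exact: free_delta.
- by move=> x [a xa]; exists (nabla a); exact: free_nabla.
- by move=> x y [a xa] [b yb]; exists (oplus a b); exact: free_oplus.
- by move=> x y [a xa] [b yb]; exists (odot a b); exact: free_odot.
Defined.

Definition free_map (x : subalgebra free_subuniverse) : A := sval (cid (svalP x)).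

Lemma free_mapP x : free_graph (sval x) (free_map x).
Proof. by rewrite /free_map; case: cid. Qed.

Lemma free_mapE x a : free_graph (sval x) a -> free_map x = a.
Proof. exact/free_graph_functional/free_mapP. Qed.

(** The coordinates are all maps from [A] to [T], so the projection at [a] is a generator sent to
    [a]; this gives surjectivity. *)
Lemma IMV_HSP : HSP T A.
Proof.
exists (A -> T), free_subuniverse, free_map; split; last first.
  move=> a; have ha : free_subuniverse (fun w => w a) by exists a; exact: free_var.
  by exists (exist _ _ ha); apply: free_mapE; exact: free_var.
split=> [|||x|x|x|x y|x y]; apply: free_mapE => /=.
- exact: free_zero.
- exact: free_one.
- exact: free_iota.
- exact/free_neg/free_mapP.
- exact/free_delta/free_mapP.
- exact/free_nabla/free_mapP.
- by apply: free_oplus; exact: free_mapP.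
- by apply: free_odot; exact: free_mapP.
Qed.

End Free.

Theorem theorem5p1 (R : realType) :
  ((forall (a b : R) (h : bounds01 a b),
      omega (mk_interval01 h) = mk_theta h) /\
   is_IMV (I01 R) /\ is_IMV (Theta R) /\
   is_iso (@omega R)) /\
  ((forall A : algebra, is_IMV A <-> HSP (I01 R) A) /\
   (forall A : algebra, HSP (I01 R) A <-> HSP (Theta R) A)) /\
  (forall s t : term,
     (forall A : algebra, is_IMV A -> satisfies A s t) <->
     satisfies (I01 R) s t).
Proof.
have iso := omega_iso R.
have [omega' iso'] := is_iso_inv iso.
have hT := Theta_IMV R.
have hI : is_IMV (I01 R).
  by case: (iso) => homega /bij_inj inj; exact: (is_IMV_inj homega inj hT).
have IMV_I01 A : is_IMV A -> HSP (I01 R) A.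
  by move=> hA; apply: (HSP_iso iso); exact: IMV_HSP.
split; first by split; [exact: omegaE|].
split; first split=> A.
- by split=> [/IMV_I01|/(HSP_IMV hI)].
- by split; [exact: HSP_iso iso'|exact: HSP_iso iso].
- move=> s t; split=> [|Ist A /IMV_I01 hA]; first exact.
  exact: HSP_satisfies Ist.
Qed.
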